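(* Let $k\ge2$, $n\ge1$ be integers, let $A\subset[k]^n$ and $f=1_A$. Then for any $\epsilon>0$, $f$ is $\epsilon$-close to some $M$-junta $g:[k]^n\to\{0,1\}$ with $$M\le\exp\!\left(\frac{C_4}{\epsilon}\sum_{j=1}^n\mathbb{E}_{x\in[k]^{n-1}}h^*(f_j^x)\right),$$ where $C_4$ is an absolute constant, the expectation is over uniform $x\in[k]^{n-1}$, and $$h^*:\{0,1\}^{[k]}\to\mathbb{R};\qquad h^*(F)=\begin{cases}0&\text{if }F\text{ is constant},\\ \mathrm{Var}(F)\log_2\frac{|\partial F|}{\mathrm{Var}(F)}&\text{otherwise.}\end{cases}$$
   Context: $[k]=\{1,\dots,k\}$. For $j\in[n]$ and $x\in[k]^{n-1}$, the fibre $a_j^x$ is the set of points of $[k]^n$ obtained by inserting an arbitrary value $y_j\in[k]$ into $x$ at position $j$; $f_j^x:[k]\to\{0,1\}$ is the restriction of $f$ to this fibre, identified with $[k]$ via $y\mapsto y_j$. For $F:[k]\to\{0,1\}$, $\mathrm{Var}(F)=p(1-p)$ with $p=|\{y:F(y)=1\}|/k$, and $|\partial F|=|\{y\in[k-1]:F(y+1)\ne F(y)\}|$. Functions $f,g:[k]^n\to\{0,1\}$ are $\epsilon$-close if $k^{-n}\sum_x|f(x)-g(x)|\le\epsilon$. $g$ is an $M$-junta if there is $J\subset[n]$ with $|J|=M$ such that $g(x)$ depends only on $(x_j)_{j\in J}$. *)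

(* Defs.v *)
From HB Require Import structures.
From mathcomp Require Import all_boot all_order all_algebra.
From mathcomp Require Import reals sequences exp.

Set Implicit Arguments.
Unset Strict Implicit.
Unset Printing Implicit Defensive.

Import Order.TTheory GRing.Theory Num.Theory.
Local Open Scope ring_scope.

(* [k] = {1, ..., k} is 'I_k and [n] is 'I_n, with values shifted by one;
   {0,1} is bool. *)
Definition grid (k n : nat) := {ffun 'I_n -> 'I_k}.

(* unlift j i is None exactly when i = j; otherwise it is the index of i among
   the n.-1 coordinates different from j. *)
Definition insert_at (k n : nat) (j : 'I_n) (x : grid k n.-1) (y : 'I_k) :
    grid k n :=
  [ffun i => if unlift j i is Some i' then x i' else y].

Definition fibre_fun (k n : nat) (f : grid k n -> bool) (j : 'I_n)
    (x : grid k n.-1) : 'I_k -> bool :=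
  fun y => f (insert_at j x y).

Definition log2 (R : realType) (t : R) : R := ln t / ln 2.

Definition mean1 (R : realType) (k : nat) (F : 'I_k -> bool) : R :=
  #|[set y | F y]|%:R / k%:R.

Definition Var (R : realType) (k : nat) (F : 'I_k -> bool) : R :=
  mean1 R F * (1 - mean1 R F).

(* ordS is the cyclic successor of 'I_k; the guard y.+1 < k excludes the
   wrap-around, so that ordS y is y + 1 and y ranges over [k-1]. *)
Definition bdry (k : nat) (F : 'I_k -> bool) : {set 'I_k} :=
  [set y : 'I_k | (y.+1 < k)%N && (F (ordS y) != F y)].

Definition is_constant (k : nat) (F : 'I_k -> bool) : bool :=
  [forall y, forall z, F y == F z].

Definition hstar (R : realType) (k : nat) (F : 'I_k -> bool) : R :=
  if is_constant F then 0
  else Var R F * log2 (#|bdry F|%:R / Var R F).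

Definition expectation_grid (R : realType) (k m : nat) (X : grid k m -> R) : R :=
  (\sum_(x : grid k m) X x) / (k ^ m)%N%:R.

Definition eps_close (R : realType) (k n : nat) (eps : R)
    (f g : grid k n -> bool) : Prop :=
  (\sum_(x : grid k n) `|(f x)%:R - (g x)%:R|) / (k ^ n)%N%:R <= eps.

Definition is_junta (k n M : nat) (g : grid k n -> bool) : Prop :=
  exists J : {set 'I_n}, #|J| = M /\
    forall x y : grid k n, (forall j, j \in J -> x j = y j) -> g x = g y.

Definition indicator (k n : nat) (A : {set grid k n}) : grid k n -> bool :=
  fun x => x \in A.

(* Main.v *)
(* The argument of Falik and Samorodnitsky, run on [k]^n with the nonlocal energy
   E(F) = (1/k) sum_{y<z} (F y - F z)^2 / (z - y) of a function F on [k].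
   Halving [k] repeatedly gives the logarithmic Sobolev inequality
   Ent(F^2) <= 5 E(F); averaging out one coordinate at a time tensorises it to
   [k]^n.  For boolean F the number of y with F(y) <> F(y + d) is at most
   min(d |dF|, 4 k Var F), whence E(F) <= 7 h*(F).  Let J be the set of
   coordinates whose mean of h* is at least 1/c.  Average f successively over the
   coordinates outside J: the energies of the increments d_i sum to at most that
   of f, and Ent(d^2) is bounded below in terms of E d^2 and the small E|d|, so
   f is L^2-close to its average over the coordinates outside J, which is then
   rounded to a boolean function. *)
Require Import Defs.
From HB Require Import structures.
From mathcomp Require Import all_boot all_order all_algebra.
From mathcomp Require Import boolp reals sequences exp.
From mathcomp Require Import ring lra zify.

Set Implicit Arguments.
Unset Strict Implicit.
Unset Printing Implicit Defensive.

Import Order.TTheory GRing.Theory Num.Theory.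
Local Open Scope ring_scope.

(** * Entropy on an interval *)

Lemma ln_leB1 (R : realType) (u : R) : 0 < u -> ln u <= u - 1.
Proof.
move=> u0; have := expR_ge1Dx (ln u).
by rewrite lnK ?posrE// -lerBrDl.
Qed.

Lemma ln_geB1V (R : realType) (u : R) : 0 < u -> 1 - u^-1 <= ln u.
Proof.
move=> u0; have := ln_leB1 (u := u^-1); rewrite invr_gt0 => /(_ u0).
by rewrite lnV ?posrE// lerNl opprB.
Qed.

(** Cauchy-Schwarz, from the nonnegative form [\sum (x a - y b)^2] at [x = v], [y = u], the two
    norms exchanged. *)
Lemma sum_mul_le_sqrt (R : realType) (I : Type) (s : seq I) (a b : I -> R) :
  \sum_(i <- s) a i * b i <=
  Num.sqrt (\sum_(i <- s) a i ^+ 2) * Num.sqrt (\sum_(i <- s) b i ^+ 2).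
Proof.
set A := \sum_(i <- s) a i ^+ 2; set B := \sum_(i <- s) b i ^+ 2.
have A0 : 0 <= A by apply: sumr_ge0 => i _; exact: sqr_ge0.
have B0 : 0 <= B by apply: sumr_ge0 => i _; exact: sqr_ge0.
set u := Num.sqrt A; set v := Num.sqrt B.
have u0 : 0 <= u by exact: sqrtr_ge0.
have v0 : 0 <= v by exact: sqrtr_ge0.
have uE : A = u ^+ 2 by rewrite sqr_sqrtr.
have vE : B = v ^+ 2 by rewrite sqr_sqrtr.
set P := \sum_(i <- s) a i * b i.
have key (x y : R) : 0 <= x ^+ 2 * A + y ^+ 2 * B - (2 * x * y) * P.
  have -> : x ^+ 2 * A + y ^+ 2 * B - 2 * x * y * P =
      \sum_(i <- s) (x * a i - y * b i) ^+ 2.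
    rewrite /A /B /P !mulr_sumr -big_split/= -sumrB; apply: eq_bigr => i _; ring.
  by apply: sumr_ge0 => i _; exact: sqr_ge0.
have /orP[/eqP u1|u1] : (u == 0) || (0 < u) by rewrite -le0r.
- rewrite u1 mul0r; have [//|P0] := lerP P 0; exfalso.
  (* With [A = 0] the form is affine in [x], and this [x] makes it [B - 2 (B + 1) < 0]. *)
  have := key ((v ^+ 2 + 1) / P) 1; rewrite uE vE u1.
  have : (v ^+ 2 + 1) / P * P = v ^+ 2 + 1 by rewrite divfK// gt_eqF.
  have := sqr_ge0 v; move: (_ / P) => x; lra.
have /orP[/eqP v1|v1] : (v == 0) || (0 < v) by rewrite -le0r.
- rewrite v1 mulr0; have [//|P0] := lerP P 0; exfalso.
  have := key 1 ((u ^+ 2 + 1) / P); rewrite uE vE v1.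
  have : (u ^+ 2 + 1) / P * P = u ^+ 2 + 1 by rewrite divfK// gt_eqF.
  have := sqr_ge0 u; move: (_ / P) => x; lra.
have := key v u; rewrite uE vE => h.
have uv0 : 0 < u * v by rewrite mulr_gt0.
rewrite -(ler_pM2l uv0); nra.
Qed.

(** Reverse triangle inequality for Euclidean norms, squared: Cauchy-Schwarz after expanding. *)
Lemma sqr_sqrtB_le (R : realType) (I : Type) (s : seq I) (a b : I -> R) :
  (Num.sqrt (\sum_(i <- s) a i ^+ 2) - Num.sqrt (\sum_(i <- s) b i ^+ 2)) ^+ 2
  <= \sum_(i <- s) (a i - b i) ^+ 2.
Proof.
have -> : \sum_(i <- s) (a i - b i) ^+ 2 = \sum_(i <- s) a i ^+ 2
    + \sum_(i <- s) b i ^+ 2 - 2 * \sum_(i <- s) a i * b i.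
  rewrite mulr_sumr -big_split/= -sumrB; apply: eq_bigr => i _; ring.
have := sum_mul_le_sqrt s a b.
rewrite sqrrB !sqr_sqrtr; try by apply: sumr_ge0 => i _; exact: sqr_ge0.
lra.
Qed.

(* Ent(g) <= Var(g) / E g, applied to the function with values a^2 and b^2. *)
Lemma two_point_entropy (R : realType) (l r A B : R) :
  0 < l -> 0 < r -> 0 <= A -> 0 <= B ->
  A * ln (A / l) + B * ln (B / r) - (A + B) * ln ((A + B) / (l + r)) <=
  (l + r) * (Num.sqrt (A / l) - Num.sqrt (B / r)) ^+ 2.
Proof.
move=> l0 r0 A0 B0.
set a := Num.sqrt (A / l); set b := Num.sqrt (B / r).
have a0 : 0 <= a by exact: sqrtr_ge0.
have b0 : 0 <= b by exact: sqrtr_ge0.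
have aE : A = l * a ^+ 2.
  by rewrite sqr_sqrtr ?divr_ge0 ?(ltW l0) ?(ltW r0)// mulrC divfK// gt_eqF.
have bE : B = r * b ^+ 2.
  by rewrite sqr_sqrtr ?divr_ge0 ?(ltW l0) ?(ltW r0)// mulrC divfK// gt_eqF.
have lr0 : 0 < l + r by rewrite addr_gt0.
have /orP[/eqP S0|S0] : (A + B == 0) || (0 < A + B).
  by rewrite -le0r addr_ge0.
  have -> : A = 0 by lra.
  have -> : B = 0 by lra.
  by rewrite !(mul0r, addr0, subr0) mulr_ge0 ?sqr_ge0// ltW.
set m := (A + B) / (l + r).
have m0 : 0 < m by rewrite divr_gt0.
have step (X t : R) : 0 <= X -> 0 < t ->
    X * ln (X / t) - X * ln m <= X * (X / t / m - 1).
  move=> X0 t0; have /orP[/eqP ->|X1] : (X == 0) || (0 < X) by rewrite -le0r.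
    by rewrite !mul0r subrr.
  rewrite -mulrBr ler_pM2l// -ln_div ?posrE ?divr_gt0//.
  by apply: ln_leB1; rewrite !divr_gt0.
have hA := step A l A0 l0; have hB := step B r B0 r0.
have : A * (A / l / m - 1) + B * (B / r / m - 1) <= (l + r) * (a - b) ^+ 2.
  have mE : m = (l * a ^+ 2 + r * b ^+ 2) / (l + r) by rewrite /m -aE -bE.
  have S1 : 0 < l * a ^+ 2 + r * b ^+ 2 by rewrite -aE -bE.
  (* The variance over the mean, times [l + r], in closed form. The factor [(a + b)^2] is removed by
     [h], whose two sides differ by [(l a - r b)^2]. *)
  have -> : A * (A / l / m - 1) + B * (B / r / m - 1) =
      l * r * (a - b) ^+ 2 * (a + b) ^+ 2 / (l * a ^+ 2 + r * b ^+ 2).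
    rewrite mE aE bE; field.
    by rewrite !gt_eqF.
  rewrite ler_pdivrMr//.
  have : 0 <= (a - b) ^+ 2 by exact: sqr_ge0.
  have h : l * r * (a + b) ^+ 2 <= (l + r) * (l * a ^+ 2 + r * b ^+ 2).
    have := sqr_ge0 (l * a - r * b); nra.
  move=> h2; have := ler_wpM2l h2 h; nra.
rewrite mulrDl; lra.
Qed.

(** Reverse triangle inequality on the product of the two blocks, where each one-variable sum is
    repeated once per point of the other block. *)
Lemma sum_cross_le (R : realType) (F : nat -> R) (a c b : nat) :
  (a < c)%N -> (c < b)%N ->
  (c - a)%N%:R * (b - c)%N%:R *
    (Num.sqrt ((\sum_(a <= y < c) F y ^+ 2) / (c - a)%N%:R) -
     Num.sqrt ((\sum_(c <= z < b) F z ^+ 2) / (b - c)%N%:R)) ^+ 2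
  <= \sum_(a <= y < c) \sum_(c <= z < b) (F y - F z) ^+ 2.
Proof.
move=> ac cb.
have := sqr_sqrtB_le [seq (y, z) | y <- index_iota a c, z <- index_iota c b]
  (fun p => F p.1) (fun p => F p.2).
rewrite !big_allpairs/=.
have -> : \sum_(a <= y < c) \sum_(c <= z < b) F y ^+ 2 =
    (b - c)%N%:R * \sum_(a <= y < c) F y ^+ 2.
  rewrite mulr_sumr; apply: eq_bigr => y _.
  by rewrite big_const_nat iter_addr_0 mulr_natl.
have -> : \sum_(a <= y < c) \sum_(c <= z < b) F z ^+ 2 =
    (c - a)%N%:R * \sum_(c <= z < b) F z ^+ 2.
  by rewrite big_const_nat iter_addr_0 mulr_natl.
move=> h; apply: le_trans h; rewrite le_eqVlt; apply/orP; left; apply/eqP.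
set l : R := (c - a)%N%:R; set r : R := (b - c)%N%:R.
have l0 : 0 < l by rewrite ltr0n subn_gt0.
have r0 : 0 < r by rewrite ltr0n subn_gt0.
set A := \sum_(a <= y < c) F y ^+ 2; set B := \sum_(c <= z < b) F z ^+ 2.
have A0 : 0 <= A by apply: sumr_ge0 => i _; exact: sqr_ge0.
have B0 : 0 <= B by apply: sumr_ge0 => i _; exact: sqr_ge0.
have -> : r * A = l * r * (A / l) by field; rewrite gt_eqF.
have -> : l * B = l * r * (B / r) by field; rewrite gt_eqF.
have lr0 : 0 <= l * r by rewrite ltW// mulr_gt0.
by rewrite !(sqrtrM _ lr0) -mulrBr exprMn sqr_sqrtr.
Qed.

(* Truncated subtraction and 0^-1 = 0 give weight 0 to the pairs z <= y. *)
Definition wt (R : realType) (y z : nat) : R := (z - y)%N%:R^-1.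

Lemma wt_ge0 (R : realType) (y z : nat) : 0 <= wt R y z.
Proof. by rewrite invr_ge0 ler0n. Qed.

(** Induction by halving: the entropy is that of the two halves plus a two-point entropy between
    their masses, which is paid for by the pairs crossing the cut. Each pair crosses exactly one
    cut, so the constant does not grow with the length. *)
Lemma entropy_interval (R : realType) (F : nat -> R) (a b : nat) :
  (a < b)%N ->
  \sum_(a <= y < b) F y ^+ 2 * ln (F y ^+ 2)
    - (\sum_(a <= y < b) F y ^+ 2) * ln ((\sum_(a <= y < b) F y ^+ 2) / (b - a)%N%:R)
  <= 5 * \sum_(a <= y < b) \sum_(a <= z < b) wt R y z * (F y - F z) ^+ 2.
Proof.
have [n] := ubnP (b - a)%N; elim: n a b => // n IH a b nab ab.
have [b1|b1] := eqVneq b a.+1.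
  rewrite b1 !big_nat1 subSn// subnn divr1 subrr mulr_ge0//.
  by rewrite mulr_ge0 ?wt_ge0 ?sqr_ge0.
pose c := (a + (b - a)./2)%N.
have ac : (a < c)%N by rewrite /c; lia.
have cb : (c < b)%N by rewrite /c; lia.
(* The halves differ in length by at most one; the extreme case, lengths 1 and 2, reads
   [9 <= 10]. *)
have klr : ((b - a) ^ 2 <= 5 * ((c - a) * (b - c)))%N.
  have [-> le2] : (b - a = (c - a) + (b - c) /\ c - a <= b - c <= (c - a).+1)%N.
    by rewrite /c; lia.
  have : (0 < c - a)%N by lia.
  by move: (c - a)%N (b - c)%N le2 => p q; nia.
have IHl := IH a c ltac:(lia) ac; have IHr := IH c b ltac:(lia) cb.
have := sum_cross_le F ac cb.
rewrite !(big_cat_nat (ltnW ac) (ltnW cb))/=.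
set l : R := (c - a)%N%:R in IHl *; set r : R := (b - c)%N%:R in IHr *.
have l0 : 0 < l by rewrite ltr0n subn_gt0.
have r0 : 0 < r by rewrite ltr0n subn_gt0.
have lrE : (b - a)%N%:R = l + r.
  by rewrite -natrD; congr (_%:R); lia.
move=> hcross.
set A := \sum_(a <= y < c) F y ^+ 2 in IHl hcross *.
set B := \sum_(c <= z < b) F z ^+ 2 in IHr hcross *.
have A0 : 0 <= A by apply: sumr_ge0 => i _; exact: sqr_ge0.
have B0 : 0 <= B by apply: sumr_ge0 => i _; exact: sqr_ge0.
have := two_point_entropy l0 r0 A0 B0; rewrite -lrE.
set D := (_ - _) ^+ 2 in hcross *.
set X := \sum_(a <= y < c) \sum_(c <= z < b) _ in hcross *.
set k : R := (b - a)%N%:R.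
have k0 : 0 < k by rewrite /k lrE addr_gt0.
(* A crossing pair has [z - y <= k], hence weight at least [1 / k]. *)
have hX : X <= k * \sum_(a <= y < c) \sum_(c <= z < b) wt R y z * (F y - F z) ^+ 2.
  rewrite /X mulr_sumr !big_nat; apply: ler_sum => y /andP[ay yc].
  rewrite mulr_sumr !big_nat; apply: ler_sum => z /andP[cz zb].
  rewrite mulrA ler_peMl ?sqr_ge0// /wt ler_pdivlMr ?mul1r ?ler_nat; last first.
    by rewrite ltr0n subn_gt0 (leq_trans yc).
  by lia.
set W := \sum_(a <= y < c) \sum_(c <= z < b) _ in hX.
have {}klr : k ^+ 2 <= 5 * (l * r) by rewrite -natrX -!natrM ler_nat.
have kD : k * D <= 5 * W.
  have W0 : 0 <= W.
    apply: sumr_ge0 => y _; apply: sumr_ge0 => z _.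
    by rewrite mulr_ge0 ?wt_ge0 ?sqr_ge0.
  have D0 : 0 <= D by exact: sqr_ge0.
  rewrite -(ler_pM2l k0).
  have h1 : k ^+ 2 * D <= 5 * (l * r) * D by rewrite ler_wpM2r.
  lra.
have spl (s : seq nat) : \sum_(y <- s) \sum_(a <= z < b) wt R y z * (F y - F z) ^+ 2 =
    \sum_(y <- s) \sum_(a <= z < c) wt R y z * (F y - F z) ^+ 2 +
    \sum_(y <- s) \sum_(c <= z < b) wt R y z * (F y - F z) ^+ 2.
  rewrite -big_split/=; apply: eq_bigr => y _.
  by rewrite (big_cat_nat (ltnW ac) (ltnW cb)).
rewrite !spl -/W.
have : 0 <= \sum_(c <= y < b) \sum_(a <= z < c) wt R y z * (F y - F z) ^+ 2.
  by apply: sumr_ge0 => y _; apply: sumr_ge0 => z _; rewrite mulr_ge0 ?wt_ge0 ?sqr_ge0.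
lra.
Qed.

(** * Averaging and tensorisation on the grid *)

Definition energy (R : realType) (k : nat) (F : 'I_k -> R) : R :=
  (\sum_(y < k) \sum_(z < k) wt R y z * (F y - F z) ^+ 2) / k%:R.

Lemma entropy_energy (R : realType) (k : nat) (F : 'I_k -> R) : (0 < k)%N ->
  (\sum_y F y ^+ 2 * ln (F y ^+ 2)) / k%:R
    - (\sum_y F y ^+ 2) / k%:R * ln ((\sum_y F y ^+ 2) / k%:R)
  <= 5 * energy F.
Proof.
case: k F => // k F _.
have := @entropy_interval R (fun y => F (inord y)) 0 k.+1 isT.
rewrite !big_mkord subn0.
under eq_bigr do rewrite inord_val.
under [X in _ - X * _]eq_bigr do rewrite inord_val.
under [X in ln (X / _)]eq_bigr do rewrite inord_val.
under [X in _ <= _ * X]eq_bigr => y _.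
  rewrite big_mkord; under eq_bigr do rewrite !inord_val.
  over.
move=> h; rewrite /energy mulrA -mulrAC -mulrBl.
by rewrite ler_wpM2r// invr_ge0 ler0n.
Qed.

Definition upd (k n : nat) (x : grid k n) (i : 'I_n) (y : 'I_k) : grid k n :=
  [ffun j => if j == i then y else x j].

Lemma upd_upd (k n : nat) (x : grid k n) i y z : upd (upd x i y) i z = upd x i z.
Proof. by apply/ffunP => j; rewrite !ffunE; case: eqP. Qed.

Lemma updC (k n : nat) (x : grid k n) i j y z : i != j ->
  upd (upd x i y) j z = upd (upd x j z) i y.
Proof.
move=> ij; apply/ffunP => l; rewrite !ffunE.
by case: eqP => // ->; rewrite eq_sym (negbTE ij).
Qed.

Lemma upd_id (k n : nat) (x : grid k n) i : upd x i (x i) = x.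
Proof. by apply/ffunP => l; rewrite !ffunE; case: eqP => // ->. Qed.

Lemma upd_at (k n : nat) (x : grid k n) i y : upd x i y i = y.
Proof. by rewrite ffunE eqxx. Qed.

(** The map [(x, y) -> (upd x i y, x i)] is an involution, so resampling coordinate [i] preserves
    the uniform measure. *)
Lemma sum_upd (R : realType) (k n : nat) (i : 'I_n) (f : grid k n -> R) :
  \sum_x \sum_y f (upd x i y) = k%:R * \sum_x f x.
Proof.
rewrite (pair_bigA _ (fun x y => f (upd x i y)))/=.
rewrite (reindex (fun p : grid k n * 'I_k => (upd p.1 i p.2, p.1 i)))/=.
  rewrite -(pair_bigA _ (fun x y => f (upd (upd x i y) i (x i))))/= mulr_sumr.
  apply: eq_bigr => x _; under eq_bigr do rewrite upd_upd upd_id.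
  by rewrite sumr_const card_ord mulr_natl.
exists (fun p : grid k n * 'I_k => (upd p.1 i p.2, p.1 i)) => -[x y] _ /=;
  by rewrite upd_upd upd_id upd_at.
Qed.

(** The conditional expectation given the other coordinates, kept as a function on the whole grid so
    that averagings compose. *)
Definition avg (R : realType) (k n : nat) (i : 'I_n) (f : grid k n -> R)
    (x : grid k n) : R :=
  (\sum_y f (upd x i y)) / k%:R.

Lemma sum_avg (R : realType) (k n : nat) (i : 'I_n) (f : grid k n -> R) :
  (0 < k)%N -> \sum_x avg i f x = \sum_x f x.
Proof.
move=> k0; rewrite -mulr_suml sum_upd mulrC mulKf// pnatr_eq0; lia.
Qed.

Lemma avg_upd (R : realType) (k n : nat) (i : 'I_n) (f : grid k n -> R) x y :
  avg i f (upd x i y) = avg i f x.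
Proof. by rewrite /avg; under eq_bigr do rewrite upd_upd. Qed.

Lemma avgB (R : realType) (k n : nat) (i : 'I_n) (f g : grid k n -> R) x :
  avg i (fun x => f x - g x) x = avg i f x - avg i g x.
Proof. by rewrite /avg sumrB mulrBl. Qed.

Lemma avgC (R : realType) (k n : nat) (i j : 'I_n) (f : grid k n -> R) x :
  avg i (avg j f) x = avg j (avg i f) x.
Proof.
have [->//|ij] := eqVneq i j.
rewrite /avg -!mulr_suml exchange_big/=; congr (_ / _ / _).
by apply: eq_bigr => y _; apply: eq_bigr => z _; rewrite updC.
Qed.

Lemma avg_ge0 (R : realType) (k n : nat) (i : 'I_n) (f : grid k n -> R) x :
  (forall x, 0 <= f x) -> 0 <= avg i f x.
Proof. by move=> f0; rewrite divr_ge0 ?ler0n// sumr_ge0. Qed.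

Lemma normr_avg_le (R : realType) (k n : nat) (i : 'I_n) (f : grid k n -> R) x :
  `|avg i f x| <= avg i (fun x => `|f x|) x.
Proof.
rewrite /avg normrM normfV (ger0_norm (ler0n _ _)).
by rewrite ler_wpM2r ?invr_ge0 ?ler0n// ler_norm_sum.
Qed.

(** Pythagoras: [avg i f] is constant along [i], hence orthogonal to [f - avg i f]. *)
Lemma sum_sqr_avg (R : realType) (k n : nat) (i : 'I_n) (f : grid k n -> R) :
  (0 < k)%N ->
  \sum_x f x ^+ 2 = \sum_x (f x - avg i f x) ^+ 2 + \sum_x avg i f x ^+ 2.
Proof.
move=> k0.
have e : \sum_x f x * avg i f x = \sum_x avg i f x ^+ 2.
  rewrite -(sum_avg i _ k0); apply: eq_bigr => x _.
  rewrite {1}/avg; under eq_bigr do rewrite avg_upd.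
  by rewrite -mulr_suml mulrAC -expr2.
have -> : \sum_x (f x - avg i f x) ^+ 2 =
    \sum_x f x ^+ 2 - 2 * \sum_x f x * avg i f x + \sum_x avg i f x ^+ 2.
  by rewrite mulr_sumr -sumrB -big_split/=; apply: eq_bigr => x _; ring.
rewrite e; ring.
Qed.

(** Unnormalised in [x]: [k ^ n] times the mean energy in direction [i]. *)
Definition dirichlet (R : realType) (k n : nat) (i : 'I_n) (f : grid k n -> R) : R :=
  \sum_x energy (fun y => f (upd x i y)).

Lemma dirichletE (R : realType) (k n : nat) (i : 'I_n) (f : grid k n -> R) :
  dirichlet i f =
  (\sum_(y < k) \sum_(z < k)
     wt R y z * \sum_x (f (upd x i y) - f (upd x i z)) ^+ 2) / k%:R.
Proof.
rewrite /dirichlet /energy -mulr_suml; congr (_ / _).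
rewrite exchange_big/=; apply: eq_bigr => y _.
by rewrite exchange_big/=; apply: eq_bigr => z _; rewrite mulr_sumr.
Qed.

Lemma dirichlet_ge0 (R : realType) (k n : nat) (i : 'I_n) (f : grid k n -> R) :
  0 <= dirichlet i f.
Proof.
apply: sumr_ge0 => x _; rewrite divr_ge0 ?ler0n// sumr_ge0// => y _.
by rewrite sumr_ge0// => z _; rewrite mulr_ge0 ?wt_ge0 ?sqr_ge0.
Qed.

Lemma dirichlet_le (R : realType) (k n : nat) (j : 'I_n) (f g : grid k n -> R) :
  (forall y z, \sum_x (f (upd x j y) - f (upd x j z)) ^+ 2 <=
     \sum_x (g (upd x j y) - g (upd x j z)) ^+ 2) ->
  dirichlet j f <= dirichlet j g.
Proof.
move=> h; rewrite !dirichletE ler_wpM2r ?invr_ge0 ?ler0n//.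
by apply: ler_sum => y _; apply: ler_sum => z _; rewrite ler_wpM2l ?wt_ge0.
Qed.

(** For [j != i], averaging over [i] commutes with changing coordinate [j], so Pythagoras applies to
    each difference; for [j = i] the averaged function has no energy. *)
Lemma dirichlet_avg_split (R : realType) (k n : nat) (i j : 'I_n)
    (f : grid k n -> R) : (0 < k)%N ->
  dirichlet j f = dirichlet j (fun x => f x - avg i f x) + dirichlet j (avg i f).
Proof.
move=> k0; rewrite !dirichletE -mulrDl -big_split/=; congr (_ / _).
apply: eq_bigr => y _; rewrite -big_split/=; apply: eq_bigr => z _.
rewrite -mulrDr; congr (_ * _); have [ij|ij] := eqVneq i j.
  rewrite -ij -big_split/=; apply: eq_bigr => x _; rewrite !avg_upd; ring.
rewrite (sum_sqr_avg i _ k0) -!big_split/=; apply: eq_bigr => x _.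
have -> : avg i (fun x => f (upd x j y) - f (upd x j z)) x =
    avg i f (upd x j y) - avg i f (upd x j z).
  rewrite avgB; congr (_ - _); rewrite /avg; congr (_ / _);
    by apply: eq_bigr => t _; rewrite updC.
ring.
Qed.

Lemma entropy_avg (R : realType) (k n : nat) (i : 'I_n) (g : grid k n -> R) :
  (0 < k)%N -> (forall x, 0 <= g x) ->
  \sum_x g x * ln (g x) - \sum_x avg i g x * ln (avg i g x)
  <= 5 * dirichlet i (fun x => Num.sqrt (g x)).
Proof.
move=> k0 g0; rewrite -(sum_avg i _ k0) -sumrB mulr_sumr; apply: ler_sum => x _.
have := entropy_energy (fun y => Num.sqrt (g (upd x i y))) k0.
under eq_bigr do rewrite sqr_sqrtr//.
under [X in _ - X / _ * _]eq_bigr do rewrite sqr_sqrtr//.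
by under [X in ln (X / _)]eq_bigr do rewrite sqr_sqrtr//.
Qed.

(** [sqrt (avg i g)] is a normalised Euclidean norm of [sqrt g] along [i], and two norms differ by
    at most the norm of the difference. *)
Lemma dirichlet_sqrt_avg (R : realType) (k n : nat) (i j : 'I_n)
    (g : grid k n -> R) : (0 < k)%N -> i != j -> (forall x, 0 <= g x) ->
  dirichlet j (fun x => Num.sqrt (avg i g x))
  <= dirichlet j (fun x => Num.sqrt (g x)).
Proof.
move=> k0 ij g0; apply: dirichlet_le => y z; rewrite -[leRHS](sum_avg i)//.
apply: ler_sum => x _; rewrite /avg.
under [X in _ <= X / _]eq_bigr do rewrite (updC _ _ _ ij) (updC _ _ _ ij).
set u := upd x j y; set v := upd x j z.
have kV0 : 0 <= k%:R^-1 :> R by rewrite invr_ge0.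
rewrite ![Num.sqrt (_ / _)]sqrtrM; try by apply: sumr_ge0 => *; exact: g0.
rewrite -mulrBl exprMn sqr_sqrtr// ler_wpM2r//.
have := sqr_sqrtB_le (index_enum 'I_k) (fun t => Num.sqrt (g (upd u i t)))
  (fun t => Num.sqrt (g (upd v i t))).
under [X in (Num.sqrt X - _) ^+ 2]eq_bigr do rewrite sqr_sqrtr//.
by under [X in (_ - Num.sqrt X) ^+ 2]eq_bigr do rewrite sqr_sqrtr//.
Qed.

Fixpoint avgs (R : realType) (k n : nat) (s : seq 'I_n) (f : grid k n -> R) :
    grid k n -> R :=
  if s is i :: s' then avgs s' (avg i f) else f.

Lemma sum_avgs (R : realType) (k n : nat) (s : seq 'I_n) (f : grid k n -> R) :
  (0 < k)%N -> \sum_x avgs s f x = \sum_x f x.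
Proof. by move=> k0; elim: s f => //= i s IH f; rewrite IH sum_avg. Qed.

(** Each averaging removes its coordinate from the set [T] of coordinates on which the function may
    depend. *)
Lemma avgs_local (R : realType) (k n : nat) (s : seq 'I_n) (T : {set 'I_n})
    (f : grid k n -> R) :
  (forall x y : grid k n, (forall j, j \in T -> x j = y j) -> f x = f y) ->
  forall x y : grid k n, (forall j, j \in T -> j \notin s -> x j = y j) ->
  avgs s f x = avgs s f y.
Proof.
elim: s T f => [|i s IH] T f fT x y xy /=; first by apply: fT => j /xy; apply.
apply: (IH (T :\ i)) => [{xy} x' y' xy|j]; last first.
  by rewrite !inE => /andP[ji jT] js; apply: xy => //; rewrite inE negb_or ji.
rewrite /avg; congr (_ / _); apply: eq_bigr => t _; apply: fT => j jT.
by rewrite !ffunE; case: eqP => // /eqP ji; apply: xy; rewrite !inE ji.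
Qed.

(** The entropy losses telescope. [uniq] keeps every later direction different from [i], so its
    energy does not increase when [g] is averaged over [i]. *)
Lemma entropy_avgs (R : realType) (k n : nat) (s : seq 'I_n) (g : grid k n -> R) :
  (0 < k)%N -> uniq s -> (forall x, 0 <= g x) ->
  \sum_x g x * ln (g x) - \sum_x avgs s g x * ln (avgs s g x)
  <= 5 * \sum_(i <- s) dirichlet i (fun x => Num.sqrt (g x)).
Proof.
move=> k0; elim: s g => [|i s IH] g /=; first by rewrite subrr big_nil mulr0.
case/andP=> nis us g0; have := entropy_avg i k0 g0.
have := IH (avg i g) us (fun x => avg_ge0 i x g0); rewrite big_cons.
have : \sum_(j <- s) dirichlet j (fun x => Num.sqrt (avg i g x)) <=
       \sum_(j <- s) dirichlet j (fun x => Num.sqrt (g x)).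
  rewrite !big_seq; apply: ler_sum => j js; apply: dirichlet_sqrt_avg => //.
  by apply: contraNneq nis => ->.
lra.
Qed.

Lemma card_grid (k n : nat) : #|{: grid k n}| = (k ^ n)%N.
Proof. by rewrite card_ffun !card_ord. Qed.

Lemma log_sobolev (R : realType) (k n : nat) (f : grid k n -> R) : (0 < k)%N ->
  \sum_x f x ^+ 2 * ln (f x ^+ 2)
    - (\sum_x f x ^+ 2) * ln ((\sum_x f x ^+ 2) / (k ^ n)%N%:R)
  <= 5 * \sum_i dirichlet i f.
Proof.
move=> k0; have g0 x : 0 <= f x ^+ 2 by exact: sqr_ge0.
have := entropy_avgs k0 (enum_uniq 'I_n) g0.
rewrite big_enum/=.
set G := avgs _ _.
(* Averaging over all coordinates leaves a constant, the mean of [f^2]. *)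
have Gcst x y : G x = G y.
  apply: (@avgs_local _ _ _ _ setT) => [u v uv|j _]; last by rewrite mem_enum.
  by congr (f _ ^+ 2); apply/ffunP => j; exact: uv.
have GE x : G x = (\sum_x f x ^+ 2) / (k ^ n)%N%:R.
  rewrite -(sum_avgs (enum 'I_n) _ k0) -/G.
  rewrite (eq_bigr (fun=> G x)) => [|y _]; last exact: Gcst.
  rewrite sumr_const card_grid -[_ *+ _]mulr_natr mulfK//.
  by rewrite pnatr_eq0 expn_eq0; lia.
have -> : \sum_x G x * ln (G x) =
    (\sum_x f x ^+ 2) * ln ((\sum_x f x ^+ 2) / (k ^ n)%N%:R).
  under eq_bigr do rewrite [X in ln X]GE.
  by rewrite -mulr_suml /G sum_avgs.
move=> h; apply: (le_trans h); rewrite ler_wpM2l//; apply: ler_sum => i _.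
(* The energies obtained are those of [sqrt (f^2) = |f|], and absolute values do not enlarge
   differences. *)
apply: dirichlet_le => y z; apply: ler_sum => x _.
rewrite !sqrtr_sqr -[leRHS]real_normK ?num_real// -[leLHS]real_normK ?num_real//.
by rewrite lerXn2r ?nnegrE// ler_dist_dist.
Qed.

(** Jensen for the logarithm with weights [d^2] gives the lower bound [2 X ln (X / A)] for the first
    sum. A second tangent inequality, with free parameter [c], turns the result into a combination
    of [X] and [A^2], which can be summed over increments. *)
Lemma entropy_ge (R : realType) (T : finType) (d : T -> R) (N c : R) :
  0 < N -> 0 < c ->
  (1 + ln c) * (\sum_x d x ^+ 2) - c / N * (\sum_x `|d x|) ^+ 2
  <= \sum_x d x ^+ 2 * ln (d x ^+ 2)
     - (\sum_x d x ^+ 2) * ln ((\sum_x d x ^+ 2) / N).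
Proof.
move=> N0 c0; set X := \sum_x d x ^+ 2; set A := \sum_x `|d x|.
have A0 : 0 <= A by apply: sumr_ge0.
have X0 : 0 <= X by apply: sumr_ge0 => x _; exact: sqr_ge0.
move: X0; rewrite le0r => /orP[/eqP X0|X0].
  have d0 x : d x ^+ 2 = 0.
    by apply: (psumr_eq0P _ X0) => // y _; exact: sqr_ge0.
  rewrite [X in _ <= X - _]big1 => [|x _]; last by rewrite d0 mul0r.
  rewrite X0 mulr0 mul0r subrr subr_le0 mulr_ge0 ?sqr_ge0// divr_ge0// ltW//.
have A1 : 0 < A.
  rewrite lt0r A0 andbT; apply: contraTneq X0 => A1.
  rewrite /X big1 ?ltxx// => x _; apply/eqP; rewrite sqrf_eq0 -normr_eq0.
  by apply/eqP; exact: (psumr_eq0P _ A1).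
(* [ln u >= 1 - 1 / u] at [u = |d x| A / X]; the scale [X / A] makes the last two terms on the left
   cancel in the sum. *)
have pt x : 2 * ln (X / A) * d x ^+ 2 + 2 * d x ^+ 2 - 2 * (X / A) * `|d x|
    <= d x ^+ 2 * ln (d x ^+ 2).
  have [->|dx] := eqVneq (d x) 0; first by rewrite normr0 expr0n/= !(mulr0, mul0r); lra.
  have n0 : 0 < `|d x| by rewrite normr_gt0.
  have XA0 : 0 < X / A by rewrite divr_gt0.
  have := @ln_geB1V R (`|d x| / (X / A)); rewrite divr_gt0// => /(_ isT).
  rewrite ln_div ?posrE// invf_div => h.
  have -> : ln (d x ^+ 2) = 2 * ln `|d x|.
    by rewrite -real_normK ?num_real// lnXn// mulr_natl.
  rewrite -[d x ^+ 2]real_normK ?num_real//.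
  have e : (X / A) * `|d x| = `|d x| ^+ 2 * (X / A / `|d x|).
    by field; rewrite !gt_eqF.
  rewrite -[2 * (X / A) * _]mulrA e.
  have := ler_wpM2l (sqr_ge0 `|d x|) h; lra.
have h1 : 2 * ln (X / A) * X <= \sum_x d x ^+ 2 * ln (d x ^+ 2).
  apply: le_trans (ler_sum _ (fun x _ => pt x)).
  rewrite sumrB big_split/= -!mulr_sumr -/X -/A.
  have -> : 2 * (X / A) * A = 2 * X by rewrite -mulrA divfK// gt_eqF.
  lra.
have XN0 : 0 < X / N by rewrite divr_gt0.
have h2 : 1 + ln c - c / N * A ^+ 2 / X <= 2 * ln (X / A) - ln (X / N).
  have := @ln_geB1V R ((X / A) ^+ 2 / (X / N) / c).
  rewrite !divr_gt0 ?exprn_gt0 ?divr_gt0// => /(_ isT).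
  rewrite !ln_div ?posrE ?divr_gt0 ?exprn_gt0 ?divr_gt0// lnXn ?divr_gt0//.
  rewrite ?ln_div ?posrE//.
  have -> : (((X / A) ^+ 2 / (X / N) / c)^-1) = c / N * A ^+ 2 / X.
    by field; rewrite !gt_eqF.
  by rewrite -mulr_natl; lra.
have := ler_wpM2r (ltW X0) h2.
have -> : (1 + ln c - c / N * A ^+ 2 / X) * X = (1 + ln c) * X - c / N * A ^+ 2.
  by rewrite mulrBl divfK// gt_eqF.
lra.
Qed.

(* The increments [d] of the successive averagings of [f] satisfy
   [dirichlet d + dirichlet (avg i f) = dirichlet f], so the logarithmic Sobolev
   inequality may be applied to each of them and summed. *)
Lemma increments_le_dirichlet (R : realType) (k n : nat) (c : R) (b : 'I_n -> R)
    (s : seq 'I_n) (f : grid k n -> R) :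
  (0 < k)%N -> 0 < c ->
  (forall i, \sum_x `|f x - avg i f x| <= b i) ->
  (1 + ln c) * (\sum_x f x ^+ 2 - \sum_x avgs s f x ^+ 2)
    - c / (k ^ n)%N%:R * \sum_(i <- s) b i ^+ 2
  <= 5 * \sum_i dirichlet i f.
Proof.
move=> k0 c0; elim: s f => [|i s IH] f fb /=.
  rewrite subrr big_nil !mulr0 subrr mulr_ge0// sumr_ge0// => i _.
  exact: dirichlet_ge0.
have N0 : 0 < (k ^ n)%N%:R :> R by rewrite ltr0n expn_gt0 k0.
(* Averagings commute and contract the L1 norm, so the same bounds [b] serve for [avg i f]. *)
have fb' j : \sum_x `|avg i f x - avg j (avg i f) x| <= b j.
  apply: le_trans (fb j); rewrite -[leRHS](sum_avg i)//; apply: ler_sum => x _.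
  by rewrite avgC -avgB; exact: normr_avg_le.
have := IH (avg i f) fb'.
have := log_sobolev (fun x => f x - avg i f x) k0.
have := entropy_ge (fun x => f x - avg i f x) N0 c0.
have : c / (k ^ n)%N%:R * (\sum_x `|f x - avg i f x|) ^+ 2
    <= c / (k ^ n)%N%:R * b i ^+ 2.
  rewrite ler_wpM2l ?divr_ge0 ?(ltW c0) ?(ltW N0)// lerXn2r// nnegrE ?sumr_ge0//.
  by apply: le_trans (fb i); rewrite sumr_ge0.
rewrite (sum_sqr_avg i f k0) big_cons.
rewrite [X in _ -> _ -> _ -> _ -> _ <= _ * X](eq_bigr _
  (fun j _ => dirichlet_avg_split i j f k0)).
rewrite big_split/=; lra.
Qed.

Lemma sum_mul_avgs (R : realType) (k n : nat) (s : seq 'I_n) (f h : grid k n -> R) :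
  (0 < k)%N -> (forall i x y, i \in s -> h (upd x i y) = h x) ->
  \sum_x avgs s f x * h x = \sum_x f x * h x.
Proof.
move=> k0; elim: s f => //= i s IH f hs.
rewrite IH => [|j x y js]; last by rewrite hs// inE js orbT.
rewrite -[RHS](sum_avg i)//; apply: eq_bigr => x _; rewrite {2}/avg.
by under [in RHS]eq_bigr do rewrite hs ?mem_head//; rewrite -mulr_suml mulrAC.
Qed.

Lemma avgs_upd (R : realType) (k n : nat) (s : seq 'I_n) (f : grid k n -> R) i x y :
  i \in s -> avgs s f (upd x i y) = avgs s f x.
Proof.
move=> si; apply: (@avgs_local _ _ _ _ setT) => [u v uv|j _ js].
  by congr f; apply/ffunP => j; exact: uv.
by rewrite ffunE; case: eqP => // ji; rewrite ji si in js.
Qed.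

(** Pythagoras for [avgs s]: the cross term comes from testing against [avgs s f], which is constant
    along [s]. *)
Lemma sum_sqr_avgs (R : realType) (k n : nat) (s : seq 'I_n) (f : grid k n -> R) :
  (0 < k)%N ->
  \sum_x (f x - avgs s f x) ^+ 2 = \sum_x f x ^+ 2 - \sum_x avgs s f x ^+ 2.
Proof.
move=> k0.
have := sum_mul_avgs f k0 (fun i x y => @avgs_upd R k n s f i x y).
have -> : \sum_x (f x - avgs s f x) ^+ 2 =
    \sum_x f x ^+ 2 - 2 * \sum_x f x * avgs s f x + \sum_x avgs s f x * avgs s f x.
  by rewrite mulr_sumr -sumrB -big_split/=; apply: eq_bigr => x _; ring.
move=> <-; under [\sum_x avgs s f x ^+ 2]eq_bigr do rewrite expr2.
ring.
Qed.

(** * The energy of a boolean function *)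

Definition jumps (R : realType) (G : nat -> bool) (k d : nat) : R :=
  \sum_(0 <= y < k - d) (G y != G (y + d)%N)%:R.

(** Pairs are grouped by their distance [d], on which alone the weight depends. *)
Lemma sum_wt (R : realType) (k : nat) (phi : nat -> nat -> R) :
  \sum_(0 <= y < k) \sum_(0 <= z < k) wt R y z * phi y z =
  \sum_(1 <= d < k) d%:R^-1 * \sum_(0 <= y < k - d) phi y (y + d)%N.
Proof.
transitivity (\sum_(0 <= y < k) \sum_(1 <= d < k | (d < k - y)%N)
    d%:R^-1 * phi y (y + d)%N).
  rewrite !big_nat; apply: eq_bigr => y /andP[_ yk].
  rewrite (big_cat_nat (n := y.+1))//= big_nat big1 ?add0r; last first.
    move=> z /andP[_ zy]; rewrite /wt.
    by have -> : (z - y = 0)%N by [lia]; rewrite invr0 mul0r.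
  rewrite -add1n big_addn (big_nat_widen _ _ k) ?leq_subr//.
  by apply: eq_bigr => d _; rewrite /wt addnK addnC.
rewrite (exchange_big_dep_nat xpredT)//=; apply: eq_bigr => d _.
rewrite mulr_sumr (big_nat_widen _ (k - d) k) ?leq_subr//=.
by apply: eq_bigl => y; apply/idP/idP; lia.
Qed.

(** A change between [y] and [y + d + 1] forces one between [y] and [y + d] or one on the last unit
    step. *)
Lemma jumps_mono (R : realType) (G : nat -> bool) (k d : nat) :
  jumps R G k d.+1 <= jumps R G k d + jumps R G k 1.
Proof.
rewrite /jumps.
have [kd|kd] := leqP k d.
  have -> : (k - d.+1 = 0)%N by lia.
  by rewrite big_geq// addr_ge0// sumr_ge0.
apply: (@le_trans _ _ (\sum_(0 <= y < k - d.+1)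
   ((G y != G (y + d)%N)%:R + (G (y + d)%N != G (y + d).+1)%:R))).
  apply: ler_sum => y _; rewrite addnS -natrD ler_nat.
  by case: (G y) (G (y + d)%N) (G (y + d).+1) => -[] [].
rewrite big_split/= lerD//.
  rewrite [leRHS](big_cat_nat (n := k - d.+1))//=; last by lia.
  by rewrite lerDl sumr_ge0.
rewrite [leRHS](big_cat_nat (n := d))//=; last by lia.
rewrite (big_addn 0 (k - 1) d)/=.
have -> : (k - 1 - d = k - d.+1)%N by lia.
under [X in _ <= _ + X]eq_bigr do rewrite addn1.
by rewrite lerDr sumr_ge0.
Qed.

Lemma jumps_le_mul (R : realType) (G : nat -> bool) (k d : nat) :
  jumps R G k d <= d%:R * jumps R G k 1.
Proof.
elim: d => [|d IH].
  by rewrite mul0r /jumps big1// => y _; rewrite addn0 eqxx.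
apply: le_trans (jumps_mono _ _ _ _) _.
by rewrite -natr1 mulrDl mul1r lerD2r.
Qed.

(** A pair with different values contains [b] exactly once, and a point lies in at most two pairs at
    distance [d]. *)
Lemma jumps_le_count (R : realType) (G : nat -> bool) (k d : nat) (b : bool) :
  jumps R G k d <= 2 * \sum_(0 <= y < k) (G y == b)%:R.
Proof.
rewrite /jumps.
have [kd|kd] := leqP k d.
  have -> : (k - d = 0)%N by lia.
  by rewrite big_geq// mulr_ge0// sumr_ge0.
apply: (@le_trans _ _ (\sum_(0 <= y < k - d)
   ((G y == b)%:R + (G (y + d)%N == b)%:R))).
  apply: ler_sum => y _; rewrite -natrD ler_nat.
  by case: b (G y) (G (y + d)%N) => -[] [].
rewrite big_split/= mulr_natl mulr2n lerD//.
  rewrite [leRHS](big_cat_nat (n := k - d))//=; last by lia.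
  by rewrite lerDl sumr_ge0.
rewrite [leRHS](big_cat_nat (n := d))//=; last by lia.
rewrite (big_addn 0 k d)/=.
by rewrite lerDr sumr_ge0.
Qed.

(** Telescoping of [1 / (m + 1) <= ln ((m + 1) / m)]. *)
Lemma harmonic_le_ln (R : realType) (D m : nat) : (0 < D)%N -> (D <= m)%N ->
  \sum_(D.+1 <= d < m.+1) d%:R^-1 <= ln (m%:R / D%:R) :> R.
Proof.
move=> D0; elim: m => [|m IH] Dm; first by lia.
have [Dm1|Dm1] := leqP D m; last first.
  have -> : m.+1 = D by lia.
  by rewrite big_geq// divff ?ln1// pnatr_eq0; lia.
rewrite big_nat_recr/=; last by lia.
have m0 : 0 < m%:R :> R by rewrite ltr0n; lia.
have D1 : 0 < D%:R :> R by rewrite ltr0n.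
have := @ln_geB1V R (m.+1%:R / m%:R); rewrite divr_gt0// => /(_ isT).
rewrite !ln_div ?posrE// invf_div.
have -> : 1 - m%:R / m.+1%:R = m.+1%:R^-1 :> R.
  by rewrite -natr1; field; rewrite natr1 pnatr_eq0.
have := IH Dm1; rewrite ln_div ?posrE//.
move: (ln m.+1%:R) (m.+1%:R^-1) => a b; lra.
Qed.

(** Distances up to [D] contribute at most [D B <= 5 k v]; the others at most [4 k v] times a
    harmonic sum, itself at most [ln (k / D) <= ln (B / v)]. *)
Lemma sum_jumps_le (R : realType) (G : nat -> bool) (k : nat) (v : R) :
  (0 < k)%N -> 0 < v -> v <= 1 / 4 -> 1 <= jumps R G k 1 ->
  (forall d, jumps R G k d <= 4 * k%:R * v) ->
  \sum_(1 <= d < k) d%:R^-1 * jumps R G k d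
  <= k%:R * v * (5 + 4 * ln (jumps R G k 1 / v)).
Proof.
move=> k0 v0 v4 B1 hW; set B := jumps R G k 1 in B1 *.
have B0 : 0 < B by lra.
have kR : 0 < k%:R :> R by rewrite ltr0n.
have kv0 : 0 < k%:R * v by rewrite mulr_gt0.
(* Below the scale D = kv/B the bound d B on jumps is used, above it 4kv. *)
have [D [Dgt0 D1 D2]] : exists D, [/\ (0 < D)%N,
    D.-1%:R * B <= k%:R * v & k%:R * v < D%:R * B].
  exists (Num.truncn (k%:R * v / B)).+1.
  have /andP[D1 D2] := truncn_itv (divr_ge0 (ltW kv0) (ltW B0)).
  by rewrite -ler_pdivlMr// -ltr_pdivrMr.
have near m : (m <= D.+1)%N ->
    \sum_(1 <= d < m) d%:R^-1 * jumps R G k d <= D%:R * B.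
  move=> mD; apply: (@le_trans _ _ (\sum_(1 <= d < m) B)).
    rewrite !big_nat; apply: ler_sum => d /andP[d1 _].
    rewrite mulrC ler_pdivrMr ?ltr0n// mulrC; exact: jumps_le_mul.
  rewrite big_const_nat iter_addr_0 -[_ *+ _]mulr_natl.
  by rewrite ler_wpM2r ?(ltW B0)// ler_nat; lia.
(* [(D - 1) B <= k v] by the choice of [D], and [B <= 4 k v] is [hW] at distance 1. *)
have DB : D%:R * B <= 5 * k%:R * v.
  have := hW 1%N; rewrite -/B.
  have -> : D%:R = D.-1%:R + 1 :> R by rewrite natr1 prednK.
  lra.
have Bv : 1 <= B / v by rewrite ler_pdivlMr//; lra.
have ln0 : 0 <= ln (B / v) by exact: ln_ge0.
have L0 : 0 <= k%:R * v * ln (B / v) by rewrite mulr_ge0// ltW.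
have [kD|Dk] := leqP k D.+1.
  by apply: le_trans (near k kD) _; lra.
have D0 : 0 < D%:R :> R by rewrite ltr0n.
rewrite (big_cat_nat (ltn0Sn D) (ltnW Dk))/=.
have := near D.+1 (leqnn _).
suff : \sum_(D.+1 <= d < k) d%:R^-1 * jumps R G k d <= 4 * k%:R * v * ln (B / v).
  lra.
apply: (@le_trans _ _ (4 * k%:R * v * \sum_(D.+1 <= d < k) d%:R^-1)).
  rewrite mulr_sumr; apply: ler_sum => d _.
  by rewrite mulrC ler_wpM2r// invr_ge0.
rewrite ler_wpM2l//; first by rewrite mulr_ge0 ?(ltW v0)// mulr_ge0// ltW.
have := @harmonic_le_ln R D k.-1 Dgt0; rewrite prednK// => h.
have Dk1 : (D <= k.-1)%N by rewrite -ltnS prednK// ltnW.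
apply: le_trans (h Dk1) _.
have k1 : 0 < k.-1%:R :> R by rewrite ltr0n (leq_trans Dgt0).
rewrite ler_ln ?posrE ?divr_gt0// ler_pdivrMr// mulrAC ler_pdivlMr//.
apply: (@le_trans _ _ (k%:R * v)); last by lra.
by rewrite ler_wpM2r ?(ltW v0)// ler_nat leq_pred.
Qed.

Lemma card_nat_sum (R : realType) (k : nat) (F : 'I_k.+1 -> bool) :
  #|[set y | F y]|%:R = \sum_(0 <= y < k.+1) (F (inord y))%:R :> R.
Proof.
rewrite big_mkord -sum1_card natr_sum big_mkcond/=; apply: eq_bigr => y _.
by rewrite inE inord_val; case: (F y).
Qed.

Lemma card_bdry (R : realType) (k : nat) (F : 'I_k.+1 -> bool) :
  #|bdry F|%:R = jumps R (fun y => F (inord y)) k.+1 1.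
Proof.
rewrite /jumps (big_nat_widen _ _ k.+1) ?leq_subr// big_mkord.
rewrite -sum1_card natr_sum [RHS]big_mkcond [LHS]big_mkcond/=.
apply: eq_bigr => y _; rewrite inE inord_val subn1/= ltnS addn1.
case: ltnP => //= yk; have -> : inord y.+1 = ordS y.
  by apply: val_inj; rewrite /= inordK ?modn_small.
by rewrite eq_sym; case: (_ == _).
Qed.

Lemma mean1_itv (R : realType) (k : nat) (F : 'I_k -> bool) :
  0 <= mean1 R F <= 1.
Proof.
rewrite /mean1 divr_ge0//=; case: k F => [|k] F; first by rewrite invr0 mulr0.
by rewrite ler_pdivrMr ?mul1r ?ler_nat// -[X in (_ <= X)%N](card_ord k.+1) max_card.
Qed.

Lemma Var_ge0 (R : realType) (k : nat) (F : 'I_k -> bool) : 0 <= Var R F.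
Proof. by have /andP[p0 p1] := mean1_itv R F; rewrite mulr_ge0// subr_ge0. Qed.

Lemma Var_le (R : realType) (k : nat) (F : 'I_k -> bool) : Var R F <= 1 / 4.
Proof. by have := sqr_ge0 (mean1 R F - 1 / 2); rewrite /Var; lra. Qed.

(** Counting the rarer value gives [2 k min(p, 1 - p)], and [min(p, 1 - p) <= 2 p (1 - p)]. *)
Lemma jumps_le_Var (R : realType) (k d : nat) (F : 'I_k.+1 -> bool) :
  jumps R (fun y => F (inord y)) k.+1 d <= 4 * k.+1%:R * Var R F.
Proof.
have := jumps_le_count R (fun y => F (inord y)) k.+1 d.
have k0 : 0 < k.+1%:R :> R by rewrite ltr0n.
have pE : \sum_(0 <= y < k.+1) (F (inord y) == true)%:R = k.+1%:R * mean1 R F.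
  rewrite /mean1 mulrC divfK ?gt_eqF// card_nat_sum.
  by apply: eq_bigr => y _; rewrite eqb_id.
have qE : \sum_(0 <= y < k.+1) (F (inord y) == false)%:R = k.+1%:R * (1 - mean1 R F).
  rewrite mulrBr mulr1 -pE; apply/eqP; rewrite eq_sym subr_eq -big_split/=.
  rewrite (eq_bigr (fun=> 1)) => [|y _]; last by case: (F _); rewrite /= ?addr0 ?add0r.
  by rewrite big_const_nat iter_addr_0 subn0 -mulr_natl mulr1.
move=> h; have := h true; have := h false; rewrite pE qE /Var.
have /andP[p0 p1] := mean1_itv R F.
move: (mean1 R F) p0 p1 => p p0 p1.
have [p2|p2] := lerP p (1 / 2) => h1 h2.
- apply: le_trans h2 _; have := mulr_ge0 (ltW k0) p0 => kp.
  have : 0 <= k.+1%:R * p * (1 - 2 * p) by rewrite mulr_ge0//; lra.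
  lra.
- apply: le_trans h1 _.
  have : 0 <= k.+1%:R * (1 - p) * (2 * p - 1) by rewrite !mulr_ge0 ?(ltW k0)//; lra.
  lra.
Qed.

Lemma jumps1_ge1 (R : realType) (k : nat) (F : 'I_k.+1 -> bool) :
  ~~ is_constant F -> 1 <= jumps R (fun y => F (inord y)) k.+1 1.
Proof.
rewrite -card_bdry ler1n lt0n; apply: contraNneq => /card0_eq b0.
have cst (m : nat) : (m < k.+1)%N -> F (inord m) = F (inord 0).
  elim: m => // m IH mk; rewrite -IH; last by lia.
  have := b0 (inord m); rewrite !inE inordK; last by lia.
  rewrite mk/= => /negbFE/eqP <-; congr F; apply: val_inj.
  by rewrite /= !inordK ?modn_small//; lia.
apply/forallP => y; apply/forallP => z.
by rewrite -[y]inord_val -[z]inord_val !cst.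
Qed.

(** Meant for [t = |dF| / Var F], at least 4 for nonconstant [F]: [log2 t] then absorbs both
    additive constants and [ln t]. *)
Lemma log2_ge (R : realType) (t : R) : 4 <= t -> 2 <= log2 t /\ ln t <= log2 t.
Proof.
move=> t4.
have l2 : 0 < ln 2 :> R by rewrite ln_gt0// ltr1n.
have l21 : ln 2 <= 1 :> R by have := @ln_leB1 R 2 ltac:(lra); lra.
have lt : 2 * ln 2 <= ln t.
  have -> : 2 * ln 2 = ln 4 :> R.
    by rewrite mulr_natl -lnXn// -natrX.
  by rewrite ler_ln ?posrE//; lra.
split; first by rewrite ler_pdivlMr.
by rewrite ler_pdivlMr// ler_piMr//; lra.
Qed.

Lemma energy_le_hstar (R : realType) (k : nat) (F : 'I_k -> bool) : (0 < k)%N ->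
  energy (fun y => (F y)%:R) <= 7 * hstar R F /\ 2 * Var R F <= hstar R F.
Proof.
case: k F => // k F _; rewrite /hstar; case: ifPn => [Fc|nc].
  have cst y z : F y = F z by exact/eqP/(forallP (forallP Fc y) z).
  split.
    rewrite mulr0 /energy big1 ?mul0r// => y _; rewrite big1// => z _.
    by rewrite (cst y z) subrr expr0n mulr0.
  rewrite /Var /mean1; case: (boolP (F ord0)) => F0.
    have -> : [set y | F y] = setT by apply/setP => y; rewrite !inE (cst y ord0).
    by rewrite cardsT card_ord divff ?pnatr_eq0// subrr !mulr0.
  have -> : [set y | F y] = set0.
    by apply/setP => y; rewrite !inE (cst y ord0) (negbTE F0).
  by rewrite cards0 !(mul0r, mulr0).
have B1 := jumps1_ge1 R nc; have hW d := jumps_le_Var R d F.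
have k0 : 0 < k.+1%:R :> R by rewrite ltr0n.
have v0 : 0 < Var R F.
  rewrite lt0r Var_ge0 andbT; apply: contraTneq B1 => v0.
  by rewrite -ltNge; have := hW 1%N; rewrite v0 mulr0; lra.
have v4 := Var_le R F.
have [] := @log2_ge R (#|bdry F|%:R / Var R F).
  by rewrite ler_pdivlMr// card_bdry; lra.
rewrite card_bdry; set l := log2 _ => l2 lnl.
split; last by rewrite mulrC ler_wpM2l ?(ltW v0).
have := sum_jumps_le (ltn0Sn k) v0 v4 B1 hW; set S := (X in X <= _) => hS.
have -> : energy (fun y => (F y)%:R : R) = S / k.+1%:R.
  rewrite /S /jumps -(sum_wt _ (fun y z => (F (inord y) != F (inord z))%:R)).
  rewrite big_mkord /energy; congr (_ / _); apply: eq_bigr => y _.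
  rewrite big_mkord; apply: eq_bigr => z _; rewrite !inord_val; congr (_ * _).
  by case: (F y) (F z) => -[] /=; ring.
(* The factor 7: since [l >= 2] and [l] bounds the natural logarithm,
   [5 + 4 ln <= 5 l / 2 + 4 l <= 7 l]. *)
rewrite ler_pdivrMr//; apply: le_trans hS _.
rewrite [leRHS]mulrC -mulrA ler_wpM2l ?(ltW k0)// mulrCA ler_wpM2l ?(ltW v0)//.
lra.
Qed.

(** * Approximation by a junta *)

Lemma mean1E (R : realType) (k : nat) (F : 'I_k -> bool) :
  mean1 R F = (\sum_y (F y)%:R) / k%:R.
Proof.
rewrite /mean1 -sum1_card natr_sum big_mkcond/=; congr (_ / _).
by apply: eq_bigr => y _; rewrite inE; case: (F y).
Qed.

(** For boolean [b], [|b - p|] is the affine expression [(1 - 2 p) b + p]. *)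
Lemma sum_norm_sub_mean (R : realType) (k : nat) (F : 'I_k -> bool) : (0 < k)%N ->
  \sum_y `|(F y)%:R - mean1 R F| = k%:R * (2 * Var R F).
Proof.
move=> k0; have k1 : k%:R != 0 :> R by rewrite pnatr_eq0 -lt0n.
have /andP[p0 p1] := mean1_itv R F.
have e : \sum_y (F y)%:R = k%:R * mean1 R F.
  by rewrite mean1E mulrC divfK.
rewrite /Var; set p := mean1 R F in p0 p1 e *.
transitivity (\sum_y ((1 - 2 * p) * (F y)%:R + p)).
  apply: eq_bigr => y _; case: (F y) => /=.
    by rewrite ger0_norm ?subr_ge0//; ring.
  by rewrite sub0r normrN ger0_norm//; ring.
rewrite big_split/= -mulr_sumr e sumr_const card_ord -[_ *+ _]mulr_natl; ring.
Qed.

(** Every fibre along [j] is met [k] times, once for each value of [x j]. *)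
Lemma sum_grid_fibre (R : realType) (k n : nat) (j : 'I_n)
    (Phi : ('I_k -> bool) -> R) (f : grid k n -> bool) : (0 < k)%N ->
  \sum_x Phi (fun y => f (upd x j y)) =
  (k ^ n)%N%:R * expectation_grid (fun x => Phi (fibre_fun f j x)).
Proof.
move=> k0; have kn0 : (k ^ n.-1)%N%:R != 0 :> R.
  by rewrite pnatr_eq0 -lt0n expn_gt0 k0.
rewrite /expectation_grid mulrCA mulrC.
have -> : (k ^ n)%N%:R / (k ^ n.-1)%N%:R = k%:R :> R.
  have -> : (k ^ n = k * k ^ n.-1)%N by rewrite -expnS (ltn_predK (ltn_ord j)).
  by rewrite natrM mulfK.
rewrite (reindex (fun p : grid k n.-1 * 'I_k => insert_at j p.1 p.2))/=; last first.
  exists (fun x : grid k n => ([ffun i => x (lift j i)] : grid k n.-1, x j)).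
    move=> [x y] _ /=; congr pair; last by rewrite ffunE unlift_none.
    by apply/ffunP => i; rewrite !ffunE liftK.
  move=> x _ /=; apply/ffunP => i; rewrite ffunE.
  by case: unliftP => [i' ->|->//]; rewrite ffunE.
rewrite -(pair_bigA _ (fun x z => Phi (fun y => f (upd (insert_at j x z) j y))))/=.
rewrite mulr_sumr; apply: eq_bigr => x _.
rewrite (eq_bigr (fun=> Phi (fibre_fun f j x))) => [|z _].
  by rewrite sumr_const card_ord mulr_natl.
congr Phi; apply/funext => y; congr f; apply/ffunP => i; rewrite !ffunE.
by case: unliftP => [i' ->|->]; rewrite ?eqxx// eq_sym (negbTE (neq_lift _ _)).
Qed.

Lemma expectation_hstar_ge0 (R : realType) (k n : nat) (j : 'I_n)
    (f : grid k n -> bool) : (0 < k)%N ->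
  0 <= expectation_grid (fun x => hstar R (fibre_fun f j x)).
Proof.
move=> k0; rewrite divr_ge0// sumr_ge0// => x _.
by have [_] := energy_le_hstar R (fibre_fun f j x) k0; apply: le_trans;
  rewrite mulr_ge0// Var_ge0.
Qed.

Lemma dirichlet_le_hstar (R : realType) (k n : nat) (j : 'I_n)
    (f : grid k n -> bool) : (0 < k)%N ->
  dirichlet j (fun x => (f x)%:R)
  <= 7 * ((k ^ n)%N%:R * expectation_grid (fun x => hstar R (fibre_fun f j x))).
Proof.
move=> k0; rewrite -sum_grid_fibre// mulr_sumr; apply: ler_sum => x _.
by have [] := energy_le_hstar R (fun y => f (upd x j y)) k0.
Qed.

(** On each fibre the mean absolute deviation is [2 Var], at most [hstar]. *)
Lemma sum_norm_sub_avg_le (R : realType) (k n : nat) (j : 'I_n)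
    (f : grid k n -> bool) : (0 < k)%N ->
  \sum_x `|(f x)%:R - avg j (fun x => (f x)%:R) x|
  <= (k ^ n)%N%:R * expectation_grid (fun x => hstar R (fibre_fun f j x)).
Proof.
move=> k0; rewrite -sum_grid_fibre// -[leLHS](sum_avg j _ k0).
apply: ler_sum => x _.
have -> : avg j (fun x => `|(f x)%:R - avg j (fun x => (f x)%:R) x|) x =
    (\sum_y `|(f (upd x j y))%:R - mean1 R (fun y => f (upd x j y))|) / k%:R.
  congr (_ / _); apply: eq_bigr => y _.
  by rewrite avg_upd (mean1E R (fun y => f (upd x j y))).
rewrite (sum_norm_sub_mean R (fun y => f (upd x j y)) k0) mulrAC divff ?mul1r.
  by have [] := energy_le_hstar R (fun y => f (upd x j y)) k0.
by rewrite pnatr_eq0 -lt0n.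
Qed.

(** A wrong rounding needs [|b - t| >= 1 / 2]. *)
Lemma round_le_sqr (R : realType) (b : bool) (t : R) :
  `|b%:R - (1 / 2 <= t)%R%:R| <= 4 * (b%:R - t) ^+ 2.
Proof.
have h0 : 0 <= 4 * (b%:R - t) ^+ 2 by rewrite mulr_ge0 ?sqr_ge0.
case: b h0 => /= h0; case: (lerP (1 / 2) t) => ht /=;
  rewrite ?(subrr, subr0, sub0r, normrN, normr0, normr1, sqrrN); nra.
Qed.

Lemma junta_approx (R : realType) (k n : nat) (f : grid k n -> bool) (H eps : R) :
  (0 < k)%N -> 0 < eps -> eps <= 1 ->
  H = \sum_(j < n) expectation_grid (fun x => hstar R (fibre_fun f j x)) ->
  exists (M : nat) (g : grid k n -> bool),
    [/\ is_junta M g, eps_close eps f g & M%:R <= expR (145 / eps * H)].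
Proof.
move=> k0 eps0 eps1 HE.
set N : R := (k ^ n)%N%:R; have N0 : 0 < N by rewrite ltr0n expn_gt0 k0.
pose h j := expectation_grid (fun x => hstar R (fibre_fun f j x)).
have {}HE : H = \sum_j h j by [].
have h0 j : 0 <= h j by exact: expectation_hstar_ge0.
have H0 : 0 <= H by rewrite HE sumr_ge0// => j _; exact: h0.
(* [144 = 4 * 36]: the energy gives [5 * 7 = 35] and the coordinates outside [J] give 1 in
   [(1 + kap) V <= 36 N H]; the target is [V <= N eps / 4], since rounding costs a factor 4. *)
pose kap := 144 / eps * H.
have kap0 : 0 <= kap by rewrite mulr_ge0// divr_ge0// ltW.
pose c := expR kap; have c0 : 0 < c by exact: expR_gt0.
pose J := [set j | 1 <= c * h j].
pose u := avgs (enum (~: J)) (fun x => (f x)%:R : R).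
exists #|J|, (fun x => 1 / 2 <= u x); split.
- exists J; split => // x y xy; suff -> : u x = u y by [].
  apply: (@avgs_local _ _ _ _ setT) => [a b ab|j _].
    by congr (f _)%:R; apply/ffunP => j; exact: ab.
  by rewrite mem_enum inE negbK; exact: xy.
- have := @increments_le_dirichlet R k n c (fun j => N * h j) (enum (~: J))
    (fun x => (f x)%:R) k0 c0 (fun j => sum_norm_sub_avg_le R j f k0).
  rewrite -sum_sqr_avgs// -/u -/N expRK.
  have : \sum_j dirichlet j (fun x => (f x)%:R : R) <= 7 * (N * H).
    rewrite HE !mulr_sumr; apply: ler_sum => j _; exact: dirichlet_le_hstar.
  set Q := \sum_j _.
  (* Outside [J], [c * h j < 1] makes the quadratic term linear. *)
  have : c / N * \sum_(j <- enum (~: J)) (N * h j) ^+ 2 <= N * H.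
    rewrite big_enum/= mulr_sumr HE mulr_sumr [leRHS](bigID (mem J))/=.
    apply: ler_wpDl.
      by rewrite sumr_ge0// => j _; rewrite mulr_ge0.
    under [leRHS]eq_bigl do rewrite -in_setC.
    apply: ler_sum => j; rewrite !inE -ltNge => ch.
    have -> : c / N * (N * h j) ^+ 2 = N * h j * (c * h j).
      by field; rewrite gt_eqF.
    by rewrite ler_piMr ?(ltW ch)// mulr_ge0.
  set V := \sum_x _; set S := c / N * _ => hS hQ hV.
  have kV : (1 + kap) * V <= (1 + kap) * (N * (eps / 4)).
    have -> : (1 + kap) * (N * (eps / 4)) = N * (eps / 4) + 36 * (N * H).
      by rewrite /kap; field; rewrite gt_eqF.
    have : 0 <= N * (eps / 4) by rewrite mulr_ge0 ?divr_ge0// ltW.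
    lra.
  have {}kV : V <= N * (eps / 4) by rewrite ler_pM2l// in kV; lra.
  rewrite /eps_close ler_pdivrMr//.
  apply: (@le_trans _ _ (4 * V)); last by rewrite -/N; lra.
  by rewrite /V mulr_sumr; apply: ler_sum => x _; exact: round_le_sqr.
(* Markov: each [j] in [J] has [c * h j >= 1], so [#|J| <= c * H]. *)
- apply: (@le_trans _ _ (c * H)).
    rewrite HE mulr_sumr [leRHS](bigID (mem J))/= -sum1_card natr_sum.
    apply: ler_wpDr; first by rewrite sumr_ge0// => j _; rewrite mulr_ge0// ltW.
    by apply: ler_sum => j; rewrite inE.
  have -> : 145 / eps * H = kap + H / eps by rewrite /kap; field; rewrite gt_eqF.
  rewrite expRD -/c ler_wpM2l ?(ltW c0)//.
  (* The remaining 1 in 145: [H <= H / eps <= expR (H / eps)], the first by [eps <= 1]. *)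
  apply: (@le_trans _ _ (H / eps)).
    by rewrite ler_pdivlMr// ler_piMr.
  by have := expR_ge1Dx (H / eps); lra.
Qed.

Theorem theorem11 (R : realType) :
  exists C4 : R, 0 < C4 /\
    forall (k n : nat), (2 <= k)%N -> (1 <= n)%N ->
    forall (A : {set grid k n}) (eps : R), 0 < eps ->
    exists (M : nat) (g : grid k n -> bool),
      [/\ is_junta M g,
          eps_close eps (indicator A) g &
          M%:R <= expR (C4 / eps *
            \sum_(j < n) expectation_grid
              (fun x : grid k n.-1 => hstar R (fibre_fun (indicator A) j x)))].
Proof.
exists 145; split=> // k n k2 _ A eps eps0.
have k0 : (0 < k)%N by exact: leq_trans k2.
have [eps1|/ltW eps1] := lerP eps 1; first exact: junta_approx.
(* Distances never exceed 1, so beyond [eps = 1] a constant, which is a 0-junta, suffices. *)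
exists 0%N, (fun=> false); split; last by rewrite expR_ge0.
  by exists set0; rewrite cards0.
rewrite /eps_close; apply: le_trans eps1.
have N0 : 0 < (k ^ n)%N%:R :> R by rewrite ltr0n expn_gt0 k0.
rewrite ler_pdivrMr// mul1r -card_grid -sum1_card natr_sum.
by apply: ler_sum => x _; rewrite subr0 normr_nat ler_nat leq_b1.
Qed.
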